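(* Let $r>2$, $p(z_1,z_2)=1-\frac{z_1+z_2}{r}$, and define the Hermitian form $$\langle g,h\rangle=\frac1{4\pi^2}\int_0^{2\pi}\!\!\int_0^{2\pi}\frac{g(e^{i\theta},e^{i\phi})\overline{h(e^{i\theta},e^{i\phi})}}{|p(e^{i\theta},e^{i\phi})|^2}\,d\theta\,d\phi$$ for square-integrable functions $g,h$ on $\mathbb{T}^2$. Let $a=\frac r2-\sqrt{\frac{r^2}{4}-1}$. Then the polynomials $$\sqrt[4]{1-\tfrac4{r^2}},\qquad z_1^k\frac{\sqrt[4]{1-\frac4{r^2}}}{\sqrt{1-a^2}}(z_1-a)\ (k\in\mathbb{Z}_+),\qquad z_2^k\frac{\sqrt[4]{1-\frac4{r^2}}}{\sqrt{1-a^2}}(z_2-a)\ (k\in\mathbb{Z}_+),$$ $$z_1^{k_1}z_2^{k_2}\left(z_1z_2-\frac{z_1}{r}-\frac{z_2}{r}\right)\ ((k_1,k_2)\in\mathbb{Z}_+^2)$$ form a complete set of orthonormal polynomials with respect to $\langle\cdot,\cdot\rangle$ (they are orthonormal and their linear span is the space of all polynomials in $z_1,z_2$).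
   Context: $\mathbb{Z}_+=\{0,1,2,\dots\}$; $\mathbb{T}^2=\{(z_1,z_2):|z_1|=|z_2|=1\}$. *)

(* Defs.v *)
From Stdlib Require Import Reals List.
From Coquelicot Require Import Coquelicot.
Open Scope R_scope.

Definition Cc := Coquelicot.Complex.C.

Fixpoint Cpow (z : Cc) (n : nat) : Cc :=
  match n with O => RtoC 1 | S m => Cmult z (Cpow z m) end.

Definition eit (t : R) : Cc := (cos t, sin t).

Definition pr (r : R) (z1 z2 : Cc) : Cc :=
  Cminus (RtoC 1) (Cdiv (Cplus z1 z2) (RtoC r)).

Definition inner (r : R) (g h : Cc -> Cc -> Cc) : Cc :=
  Cmult (RtoC (/ (4 * PI ^ 2)))
    (RInt (V := C_R_CompleteNormedModule) (fun th =>
       RInt (V := C_R_CompleteNormedModule) (fun ph =>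
         Cdiv (Cmult (g (eit th) (eit ph)) (Cconj (h (eit th) (eit ph))))
              (RtoC (Cmod (pr r (eit th) (eit ph)) ^ 2)))
         0 (2 * PI)) 0 (2 * PI)).

Definition aa (r : R) : R := r / 2 - sqrt (r ^ 2 / 4 - 1).

Definition q4 (r : R) : R := sqrt (sqrt (1 - 4 / r ^ 2)).

Inductive idx : Type :=
| Iconst : idx
| Iz1 : nat -> idx
| Iz2 : nat -> idx
| Iz12 : nat -> nat -> idx.

Definition onfam (r : R) (i : idx) : Cc -> Cc -> Cc :=
  match i with
  | Iconst => fun _ _ => RtoC (q4 r)
  | Iz1 k => fun z1 _ =>
      Cmult (Cpow z1 k)
        (Cmult (RtoC (q4 r / sqrt (1 - aa r ^ 2))) (Cminus z1 (RtoC (aa r))))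
  | Iz2 k => fun _ z2 =>
      Cmult (Cpow z2 k)
        (Cmult (RtoC (q4 r / sqrt (1 - aa r ^ 2))) (Cminus z2 (RtoC (aa r))))
  | Iz12 k1 k2 => fun z1 z2 =>
      Cmult (Cmult (Cpow z1 k1) (Cpow z2 k2))
        (Cminus (Cminus (Cmult z1 z2) (Cdiv z1 (RtoC r))) (Cdiv z2 (RtoC r)))
  end.

Definition poly_eval (L : list (Cc * nat * nat)) (z1 z2 : Cc) : Cc :=
  fold_right (fun t acc =>
    let '(c, m, n) := t in Cplus (Cmult c (Cmult (Cpow z1 m) (Cpow z2 n))) acc)
    (RtoC 0) L.

Definition span_eval (r : R) (L : list (Cc * idx)) (z1 z2 : Cc) : Cc :=
  fold_right (fun t acc =>
    let '(c, i) := t in Cplus (Cmult c (onfam r i z1 z2)) acc)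
    (RtoC 0) L.

(* Main.v *)
(* Let [c m n] be the mean over the torus of [z1^m z2^n / |p|^2].  Only three facts about these
   moments are needed: they are bounded, [c (-m) (-n)] is the conjugate of [c m n], and
   multiplying back by [p] and its conjugate gives the moments of [1].  As [2/r < 1], bounded
   solutions of the resulting recurrences are rigid: a bounded sequence that is contracted into
   itself vanishes.  This yields that the moments of [p / |p|^2] with a negative index vanish,
   that [c] is symmetric (so the two iterated integrals never have to be exchanged), that
   [c (j+1) 0 = a c j 0] for [j >= 0], and that the same relation holds along every row of the
   quadrant [c k (-l)].  Orthonormality then follows by expanding into monomials.
   For completeness, [z1^(m+1) z2^(n+1)] is the family member [(m,n)] plus [1/r] times two
   monomials of lower degree. *)
Require Import Defs.
From Stdlib Require Import Reals List ZArith Lra Lia.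
From Coquelicot Require Import Coquelicot.
Open Scope R_scope.

(** * Integration of complex-valued functions of a real variable *)

(** The integral lives in a module over the reals, whose scaling only covers real factors; a complex
    factor is therefore treated through real and imaginary parts. *)
Lemma is_RInt_Cmult (k : C) (f : R -> C) (a b : R) (l : C) :
  is_RInt (V := C_R_NormedModule) f a b l ->
  is_RInt (V := C_R_NormedModule) (fun x => Cmult k (f x)) a b (Cmult k l).
Proof.
  intros H.
  pose proof (is_RInt_fct_extend_fst (U := R_NormedModule) (V := R_NormedModule) f a b l H) as H1.
  pose proof (is_RInt_fct_extend_snd (U := R_NormedModule) (V := R_NormedModule) f a b l H) as H2.
  apply (is_RInt_fct_extend_pair (U := R_NormedModule) (V := R_NormedModule)).
  - exact (is_RInt_minus _ _ _ _ _ _ (is_RInt_scal _ _ _ (fst k) _ H1)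
      (is_RInt_scal _ _ _ (snd k) _ H2)).
  - exact (is_RInt_plus _ _ _ _ _ _ (is_RInt_scal _ _ _ (fst k) _ H2)
      (is_RInt_scal _ _ _ (snd k) _ H1)).
Qed.

Lemma is_RInt_Cconj (f : R -> C) (a b : R) (l : C) :
  is_RInt (V := C_R_NormedModule) f a b l ->
  is_RInt (V := C_R_NormedModule) (fun x => Cconj (f x)) a b (Cconj l).
Proof.
  intros H.
  pose proof (is_RInt_fct_extend_fst (U := R_NormedModule) (V := R_NormedModule) f a b l H) as H1.
  pose proof (is_RInt_fct_extend_snd (U := R_NormedModule) (V := R_NormedModule) f a b l H) as H2.
  apply (is_RInt_fct_extend_pair (U := R_NormedModule) (V := R_NormedModule)).
  - exact H1.
  - exact (is_RInt_opp _ _ _ _ H2).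
Qed.

Lemma Cmod_is_RInt_le (f : R -> C) (a b B : R) (l : C) :
  a <= b -> (forall x, Cmod (f x) <= B) ->
  is_RInt (V := C_R_NormedModule) f a b l -> Cmod l <= (b - a) * B.
Proof.
  intros Hab HB H.
  rewrite Cmod_norm.
  refine (norm_RInt_le (V := C_R_NormedModule) f (fun _ => B) a b l _ Hab
    _ H (is_RInt_const a b B)).
  intros x _. rewrite <- Cmod_norm. apply HB.
Qed.

(** * Bounded Lipschitz functions and their normalised means over the torus *)

Definition lipschitz (f : R -> C) : Prop :=
  exists L, forall x x', Cmod (Cminus (f x) (f x')) <= L * Rabs (x - x').

Lemma ex_RInt_lipschitz (f : R -> C) (a b : R) :
  lipschitz f -> ex_RInt (V := C_R_NormedModule) f a b.
Proof.
  intros [L HL].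
  apply (ex_RInt_continuous (V := C_R_CompleteNormedModule)).
  intros x _. apply filterlim_locally. intros eps.
  (* [L] carries no sign condition, so [Rmax L 1] supplies a positive constant to divide by. *)
  assert (HM : 0 < Rmax L 1) by (eapply Rlt_le_trans; [apply Rlt_0_1 | apply Rmax_r]).
  assert (Hd : 0 < eps / Rmax L 1) by (apply Rdiv_lt_0_compat; [apply cond_pos | exact HM]).
  exists (mkposreal _ Hd). intros y Hy.
  assert (Hm : Cmod (Cminus (f y) (f x)) < eps).
  { eapply Rle_lt_trans; [apply HL |].
    change (Rabs (y - x) < eps / Rmax L 1) in Hy.
    apply Rle_lt_trans with (Rmax L 1 * Rabs (y - x)).
    - apply Rmult_le_compat_r; [apply Rabs_pos | apply Rmax_l].
    - apply (Rmult_lt_compat_l (Rmax L 1)) in Hy; [| exact HM].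
      replace (Rmax L 1 * (eps / Rmax L 1)) with (pos eps) in Hy by (field; lra).
      exact Hy. }
  pose proof (Rmax_Cmod (Cminus (f y) (f x))) as HR.
  split.
  - change (Rabs (fst (f y) - fst (f x)) < eps).
    eapply Rle_lt_trans; [| exact Hm]. eapply Rle_trans; [apply Rmax_l | exact HR].
  - change (Rabs (snd (f y) - snd (f x)) < eps).
    eapply Rle_lt_trans; [| exact Hm]. eapply Rle_trans; [apply Rmax_r | exact HR].
Qed.

(* The Lipschitz condition is joint, so the inner integral is Lipschitz in the outer variable
   and the iterated integral exists. *)
Definition bounded_lip (F : R -> R -> C) : Prop :=
  (exists B, forall x y, Cmod (F x y) <= B) /\
  (exists L, forall x y x' y',
     Cmod (Cminus (F x y) (F x' y')) <= L * (Rabs (x - x') + Rabs (y - y'))).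

Definition integral2 (F : R -> R -> C) : C :=
  RInt (V := C_R_CompleteNormedModule) (fun th =>
    RInt (V := C_R_CompleteNormedModule) (fun ph => F th ph) 0 (2 * PI)) 0 (2 * PI).

Definition mean (F : R -> R -> C) : C :=
  Cmult (RtoC (/ (4 * PI ^ 2))) (integral2 F).

Lemma bounded_lip_is_RInt_inner (F : R -> R -> C) (x : R) : bounded_lip F ->
  is_RInt (V := C_R_NormedModule) (fun y => F x y) 0 (2 * PI)
    (RInt (V := C_R_CompleteNormedModule) (fun y => F x y) 0 (2 * PI)).
Proof.
  intros [_ [L HL]].
  apply (RInt_correct (V := C_R_CompleteNormedModule)), ex_RInt_lipschitz.
  exists L. intros y y'. eapply Rle_trans; [apply HL |].
  rewrite Rminus_diag, Rabs_R0, Rplus_0_l. lra.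
Qed.

Lemma bounded_lip_is_RInt_outer (F : R -> R -> C) : bounded_lip F ->
  is_RInt (V := C_R_NormedModule)
    (fun x => RInt (V := C_R_CompleteNormedModule) (fun y => F x y) 0 (2 * PI)) 0 (2 * PI)
    (integral2 F).
Proof.
  intros HF.
  apply (RInt_correct (V := C_R_CompleteNormedModule)), ex_RInt_lipschitz.
  pose proof HF as [_ [L HL]].
  exists (2 * PI * L). intros x x'.
  pose proof (is_RInt_minus (V := C_R_NormedModule) _ _ _ _ _ _
    (bounded_lip_is_RInt_inner F x HF) (bounded_lip_is_RInt_inner F x' HF)) as H.
  pose proof PI_RGT_0.
  eapply Rle_trans.
  - refine (Cmod_is_RInt_le _ 0 (2 * PI) (L * Rabs (x - x')) _ _ _ H); [lra |].
    intros y. eapply Rle_trans; [apply HL |].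
    rewrite Rminus_diag, Rabs_R0, Rplus_0_r. lra.
  - lra.
Qed.

(** Naming the inner integral as a function [g] lets an identity for [is_RInt] pass through both
    layers in turn; additivity, scaling, conjugation and the mean of a monomial all use this. *)
Lemma mean_of_iterated (F : R -> R -> C) (g : R -> C) (l : C) :
  (forall x, is_RInt (V := C_R_NormedModule) (fun y => F x y) 0 (2 * PI) (g x)) ->
  is_RInt (V := C_R_NormedModule) g 0 (2 * PI) l ->
  mean F = Cmult (RtoC (/ (4 * PI ^ 2))) l.
Proof.
  intros H1 H2. unfold mean. f_equal.
  apply (is_RInt_unique (V := C_R_CompleteNormedModule)).
  apply (is_RInt_ext (V := C_R_NormedModule)) with (2 := H2).
  intros x _. symmetry. apply (is_RInt_unique (V := C_R_CompleteNormedModule)), H1.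
Qed.

Lemma mean_ext (F G : R -> R -> C) : (forall x y, F x y = G x y) -> mean F = mean G.
Proof.
  intros H. unfold mean, integral2. f_equal.
  apply (RInt_ext (V := C_R_CompleteNormedModule)). intros x _.
  apply (RInt_ext (V := C_R_CompleteNormedModule)). intros y _. apply H.
Qed.

Lemma mean_plus (F G : R -> R -> C) : bounded_lip F -> bounded_lip G ->
  mean (fun x y => Cplus (F x y) (G x y)) = Cplus (mean F) (mean G).
Proof.
  intros HF HG.
  etransitivity; [refine (mean_of_iterated _ _ _
    (fun x => is_RInt_plus (V := C_R_NormedModule) _ _ _ _ _ _
       (bounded_lip_is_RInt_inner F x HF) (bounded_lip_is_RInt_inner G x HG))
    (is_RInt_plus (V := C_R_NormedModule) _ _ _ _ _ _
       (bounded_lip_is_RInt_outer F HF) (bounded_lip_is_RInt_outer G HG))) |].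
  unfold mean. apply Cmult_plus_distr_l.
Qed.

Lemma mean_scal (k : C) (F : R -> R -> C) : bounded_lip F ->
  mean (fun x y => Cmult k (F x y)) = Cmult k (mean F).
Proof.
  intros HF.
  etransitivity; [refine (mean_of_iterated _ _ _
    (fun x => is_RInt_Cmult k _ _ _ _ (bounded_lip_is_RInt_inner F x HF))
    (is_RInt_Cmult k _ _ _ _ (bounded_lip_is_RInt_outer F HF))) |].
  unfold mean. ring.
Qed.

Lemma mean_conj (F : R -> R -> C) : bounded_lip F ->
  mean (fun x y => Cconj (F x y)) = Cconj (mean F).
Proof.
  intros HF.
  etransitivity; [refine (mean_of_iterated _ _ _
    (fun x => is_RInt_Cconj _ _ _ _ (bounded_lip_is_RInt_inner F x HF))
    (is_RInt_Cconj _ _ _ _ (bounded_lip_is_RInt_outer F HF))) |].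
  unfold mean. apply injective_projections; simpl; ring.
Qed.

Lemma Cmod_mean_le (F : R -> R -> C) (B : R) : bounded_lip F ->
  (forall x y, Cmod (F x y) <= B) -> Cmod (mean F) <= B.
Proof.
  intros HF HB. pose proof PI_RGT_0 as Hpi.
  assert (H : Cmod (integral2 F) <= (2 * PI - 0) * ((2 * PI - 0) * B)).
  { refine (Cmod_is_RInt_le _ 0 (2 * PI) _ _ _ _ (bounded_lip_is_RInt_outer F HF)); [lra |].
    intros x.
    refine (Cmod_is_RInt_le _ 0 (2 * PI) _ _ _ _ (bounded_lip_is_RInt_inner F x HF)); [lra |].
    intros y. apply HB. }
  unfold mean. rewrite Cmod_mult, Cmod_R.
  assert (Hp : 0 < 4 * PI ^ 2) by nra.
  rewrite Rabs_pos_eq by (left; apply Rinv_0_lt_compat, Hp).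
  apply (Rmult_le_reg_l (4 * PI ^ 2)); [exact Hp |].
  rewrite <- Rmult_assoc, Rinv_r, Rmult_1_l by lra. lra.
Qed.

(** * Closure properties of bounded Lipschitz functions *)

Lemma bounded_lip_const (k : C) : bounded_lip (fun _ _ => k).
Proof.
  split.
  - exists (Cmod k). intros _ _. lra.
  - exists 0. intros. unfold Cminus. rewrite Cplus_opp_r, Cmod_0. lra.
Qed.

Lemma bounded_lip_plus (F G : R -> R -> C) : bounded_lip F -> bounded_lip G ->
  bounded_lip (fun x y => Cplus (F x y) (G x y)).
Proof.
  intros [[B HB] [L HL]] [[B' HB'] [L' HL']]. split.
  - exists (B + B'). intros x y. eapply Rle_trans; [apply Cmod_triangle |].
    apply Rplus_le_compat; auto.
  - exists (L + L'). intros x y x' y'.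
    replace (Cminus (Cplus (F x y) (G x y)) (Cplus (F x' y') (G x' y')))
      with (Cplus (Cminus (F x y) (F x' y')) (Cminus (G x y) (G x' y'))) by ring.
    eapply Rle_trans; [apply Cmod_triangle |].
    rewrite Rmult_plus_distr_r. apply Rplus_le_compat; auto.
Qed.

Lemma bounded_lip_mult (F G : R -> R -> C) : bounded_lip F -> bounded_lip G ->
  bounded_lip (fun x y => Cmult (F x y) (G x y)).
Proof.
  intros [[B HB] [L HL]] [[B' HB'] [L' HL']]. split.
  - exists (B * B'). intros x y. rewrite Cmod_mult.
    apply Rmult_le_compat; auto using Cmod_ge_0.
  - exists (B * L' + L * B'). intros x y x' y'.
    replace (Cminus (Cmult (F x y) (G x y)) (Cmult (F x' y') (G x' y')))
      with (Cplus (Cmult (F x y) (Cminus (G x y) (G x' y')))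
                  (Cmult (Cminus (F x y) (F x' y')) (G x' y'))) by ring.
    eapply Rle_trans; [apply Cmod_triangle |]. rewrite !Cmod_mult.
    replace ((B * L' + L * B') * (Rabs (x - x') + Rabs (y - y'))) with
      (B * (L' * (Rabs (x - x') + Rabs (y - y'))) + L * (Rabs (x - x') + Rabs (y - y')) * B')
      by ring.
    apply Rplus_le_compat; apply Rmult_le_compat; auto using Cmod_ge_0.
Qed.

Lemma bounded_lip_conj (F : R -> R -> C) : bounded_lip F -> bounded_lip (fun x y => Cconj (F x y)).
Proof.
  intros [[B HB] [L HL]]. split.
  - exists B. intros x y. rewrite Cmod_conj. apply HB.
  - exists L. intros x y x' y'.
    replace (Cminus (Cconj (F x y)) (Cconj (F x' y'))) with (Cconj (Cminus (F x y) (F x' y')))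
      by (apply injective_projections; simpl; ring).
    rewrite Cmod_conj. apply HL.
Qed.

(** Since [1/u - 1/v = (1/u) (v - u) (1/v)], the Lipschitz constant is multiplied by [1/d] twice. *)
Lemma bounded_lip_inv (F : R -> R -> C) (d : R) : 0 < d -> (forall x y, d <= Cmod (F x y)) ->
  bounded_lip F -> bounded_lip (fun x y => Cinv (F x y)).
Proof.
  intros Hd HdF [_ [L HL]].
  assert (HF0 : forall x y, F x y <> RtoC 0).
  { intros x y. apply Cmod_gt_0. eapply Rlt_le_trans; [exact Hd | apply HdF]. }
  assert (HB : forall x y, Cmod (Cinv (F x y)) <= / d).
  { intros x y. rewrite Cmod_inv by apply HF0. apply Rinv_le_contravar; auto. }
  split; [exists (/ d); exact HB |].
  exists (/ d * L * / d). intros x y x' y'.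
  replace (Cminus (Cinv (F x y)) (Cinv (F x' y'))) with
    (Cmult (Cmult (Cinv (F x y)) (Cminus (F x' y') (F x y))) (Cinv (F x' y')))
    by (field; split; apply HF0).
  rewrite !Cmod_mult.
  replace (/ d * L * / d * (Rabs (x - x') + Rabs (y - y'))) with
    (/ d * (L * (Rabs (x - x') + Rabs (y - y'))) * / d) by ring.
  apply Rmult_le_compat; auto using Cmod_ge_0, Rmult_le_pos.
  apply Rmult_le_compat; auto using Cmod_ge_0.
  rewrite (Rabs_minus_sym x), (Rabs_minus_sym y). apply HL.
Qed.

(** * Rigidity of bounded solutions of contracting recurrences *)

(** Iterating the recurrence [N] times bounds the value by [(al + be)^N * B], which tends to [0].
    The predicate [P] confines the recurrence to a region closed under both successors; [be = 0]
    gives recurrences with a single successor. *)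
Lemma contraction_zero {T : Type} (P : T -> Prop) (f : T -> C) (s1 s2 : T -> T) (al be : R) :
  0 <= al -> 0 <= be -> al + be < 1 ->
  (exists B, forall x, Cmod (f x) <= B) ->
  (forall x, P x -> P (s1 x) /\ P (s2 x)) ->
  (forall x, P x -> f x = Cplus (Cmult (RtoC al) (f (s1 x))) (Cmult (RtoC be) (f (s2 x)))) ->
  forall x, P x -> f x = RtoC 0.
Proof.
  intros Hal Hbe Hq [B HB] Hs Hf.
  assert (HN : forall N x, P x -> Cmod (f x) <= (al + be) ^ N * B).
  { induction N as [| N IH]; intros x Hx.
    - simpl. rewrite Rmult_1_l. apply HB.
    - destruct (Hs x Hx) as [H1 H2].
      rewrite (Hf x Hx). eapply Rle_trans; [apply Cmod_triangle |].
      rewrite !Cmod_mult, !Cmod_R, !Rabs_pos_eq by assumption.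
      pose proof (Rmult_le_compat_l al _ _ Hal (IH _ H1)).
      pose proof (Rmult_le_compat_l be _ _ Hbe (IH _ H2)).
      simpl. lra. }
  intros x Hx. apply Cmod_eq_0, Rle_antisym; [| apply Cmod_ge_0].
  apply Rnot_lt_le. intros Hpos.
  assert (HB0 : 0 < B) by (eapply Rlt_le_trans; [exact Hpos | apply HB]).
  destruct (pow_lt_1_zero (al + be)) with (y := Cmod (f x) / B) as [N H].
  - rewrite Rabs_pos_eq; lra.
  - apply Rdiv_lt_0_compat; assumption.
  - specialize (H N (le_n N)). specialize (HN N x Hx).
    rewrite Rabs_pos_eq in H by (apply pow_le; lra).
    apply (Rmult_lt_compat_r B) in H; [| exact HB0].
    replace (Cmod (f x) / B * B) with (Cmod (f x)) in H by (field; lra). lra.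
Qed.

(** * The recurrences satisfied by the moments *)

(** These are the moments of the constant function [1]. *)
Definition delta (m n : Z) : C :=
  if (Z.eqb m 0 && Z.eqb n 0)%bool then RtoC 1 else RtoC 0.

(* [mulp], [mulpc]: effect on the moments of multiplying the function by [p],
   resp. by its conjugate. *)
Definition mulp (r : R) (c : Z -> Z -> C) (m n : Z) : C :=
  Cminus (c m n) (Cmult (RtoC (/ r)) (Cplus (c (m + 1)%Z n) (c m (n + 1)%Z))).

Definition mulpc (r : R) (c : Z -> Z -> C) (m n : Z) : C :=
  Cminus (c m n) (Cmult (RtoC (/ r)) (Cplus (c (m - 1)%Z n) (c m (n - 1)%Z))).

Definition bounded2 (c : Z -> Z -> C) : Prop := exists B, forall m n, Cmod (c m n) <= B.

(** The three clauses reflect that [1 / |p|^2] is bounded, is real, and becomes [1] after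
    multiplication by [p] and its conjugate. Everything about the moments is deduced from them
    alone. *)
Definition weight_coefs (r : R) (c : Z -> Z -> C) : Prop :=
  bounded2 c /\ (forall m n, c (- m)%Z (- n)%Z = Cconj (c m n)) /\
  (forall m n, mulpc r (mulp r c) m n = delta m n).

Lemma delta_neq (m n : Z) : (m <> 0 \/ n <> 0)%Z -> delta m n = RtoC 0.
Proof.
  intros H. unfold delta.
  destruct (Z.eqb_spec m 0), (Z.eqb_spec n 0); simpl; try reflexivity. lia.
Qed.

Lemma delta_sym (m n : Z) : delta m n = delta n m.
Proof. unfold delta. now rewrite Bool.andb_comm. Qed.

Lemma bounded2_lin (k : C) (c d : Z -> Z -> C) : bounded2 c -> bounded2 d ->
  bounded2 (fun m n => Cplus (c m n) (Cmult k (d m n))).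
Proof.
  intros [B HB] [B' HB']. exists (B + Cmod k * B'). intros m n.
  eapply Rle_trans; [apply Cmod_triangle |]. rewrite Cmod_mult.
  apply Rplus_le_compat; [apply HB |].
  apply Rmult_le_compat_l; [apply Cmod_ge_0 | apply HB'].
Qed.

Lemma bounded2_reindex (s t : Z -> Z -> Z) (c : Z -> Z -> C) : bounded2 c ->
  bounded2 (fun m n => c (s m n) (t m n)).
Proof. intros [B HB]. exists B. auto. Qed.

Lemma bounded2_ext (c d : Z -> Z -> C) : (forall m n, d m n = c m n) -> bounded2 c -> bounded2 d.
Proof. intros H [B HB]. exists B. intros. rewrite H. apply HB. Qed.

Lemma bounded2_sub_swap (c : Z -> Z -> C) : bounded2 c ->
  bounded2 (fun m n => Cminus (c m n) (c n m)).
Proof.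
  intros H.
  apply bounded2_ext with (2 := bounded2_lin (RtoC (Ropp 1)) c _ H
    (bounded2_reindex (fun m n => n) (fun m n => m) c H)).
  intros m n. rewrite RtoC_opp. ring.
Qed.

Lemma bounded2_mulp (r : R) (c : Z -> Z -> C) : bounded2 c -> bounded2 (mulp r c).
Proof.
  intros H.
  apply bounded2_ext with (2 := bounded2_lin (RtoC (- / r)) c _ H
    (bounded2_lin (RtoC 1) _ _
      (bounded2_reindex (fun m _ => (m + 1)%Z) (fun _ n => n) c H)
      (bounded2_reindex (fun m _ => m) (fun _ n => (n + 1)%Z) c H))).
  intros m n. unfold mulp. rewrite RtoC_opp. ring.
Qed.

(** Here [r > 2] becomes a contraction: each of the two shifts in [p] has weight [1/r], and
    [2/r < 1]. *)
Lemma contraction_rate (r : R) : 2 < r -> 0 <= / r /\ / r + / r < 1.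
Proof.
  intros hr. split; [left; apply Rinv_0_lt_compat; lra |].
  apply (Rmult_lt_reg_r r); [lra |]. rewrite Rmult_plus_distr_r, Rinv_l; lra.
Qed.

(** A zero of [mulpc] equals [1/r] times the sum of its two backward neighbours, so the contraction
    argument applies on any region stable under decrementing either index. *)
Lemma mulpc_injective_on (r : R) (P : Z -> Z -> Prop) (c : Z -> Z -> C) : 2 < r ->
  bounded2 c -> (forall m n, P m n -> P (m - 1)%Z n /\ P m (n - 1)%Z) ->
  (forall m n, P m n -> mulpc r c m n = RtoC 0) -> forall m n, P m n -> c m n = RtoC 0.
Proof.
  intros hr [B HB] HP H m n Hmn. destruct (contraction_rate r hr) as [h1 h2].
  apply (contraction_zero (fun x => P (fst x) (snd x)) (fun x : Z * Z => c (fst x) (snd x))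
    (fun x => (fst x - 1, snd x)%Z) (fun x => (fst x, snd x - 1)%Z) (/ r) (/ r)
    h1 h1 h2) with (x := (m, n)); [exists B; auto | now intros x; apply HP | | exact Hmn].
  intros [i j] Hij. simpl in *. specialize (H i j Hij). unfold mulpc in H.
  apply Ceq_minus. rewrite <- H. ring.
Qed.

Lemma mulp_injective_on (r : R) (P : Z -> Z -> Prop) (c : Z -> Z -> C) : 2 < r ->
  bounded2 c -> (forall m n, P m n -> P (m + 1)%Z n /\ P m (n + 1)%Z) ->
  (forall m n, P m n -> mulp r c m n = RtoC 0) -> forall m n, P m n -> c m n = RtoC 0.
Proof.
  intros hr [B HB] HP H m n Hmn. destruct (contraction_rate r hr) as [h1 h2].
  apply (contraction_zero (fun x => P (fst x) (snd x)) (fun x : Z * Z => c (fst x) (snd x))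
    (fun x => (fst x + 1, snd x)%Z) (fun x => (fst x, snd x + 1)%Z) (/ r) (/ r)
    h1 h1 h2) with (x := (m, n)); [exists B; auto | now intros x; apply HP | | exact Hmn].
  intros [i j] Hij. simpl in *. specialize (H i j Hij). unfold mulp in H.
  apply Ceq_minus. rewrite <- H. ring.
Qed.

(** * Vanishing, symmetry and geometric decay of the moments *)

(** The sequence [mulp r c] plays the role of the moments of [1 / conj p], and [mulpc] sends it to
    [delta]. The region where some index is negative avoids the origin and is stable under
    decrements, so rigidity applies there. *)
Lemma mulp_weight_vanish (r : R) (c : Z -> Z -> C) (m n : Z) : 2 < r ->
  weight_coefs r c -> (m < 0 \/ n < 0)%Z -> mulp r c m n = RtoC 0.
Proof.
  intros hr [Hb [_ H]]. revert m n.
  apply (mulpc_injective_on r (fun m n => (m < 0 \/ n < 0)%Z)); auto using bounded2_mulp.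
  - intros; lia.
  - intros m n Hmn. rewrite H. apply delta_neq. lia.
Qed.

(** [delta] is symmetric and both operators commute with swapping the indices. Rigidity on the whole
    lattice thus removes first [mulpc], giving the symmetry of [mulp r c], and then [mulp]. *)
Lemma weight_coefs_sym (r : R) (c : Z -> Z -> C) (m n : Z) : 2 < r ->
  weight_coefs r c -> c m n = c n m.
Proof.
  intros hr [Hb [_ H]].
  assert (Hv : forall i j, mulp r c i j = mulp r c j i).
  { intros i j. apply Ceq_minus.
    apply (mulpc_injective_on r (fun _ _ => True)
             (fun i j => Cminus (mulp r c i j) (mulp r c j i))); auto.
    - apply bounded2_sub_swap, bounded2_mulp, Hb.
    - intros m' n' _.
      transitivity (Cminus (mulpc r (mulp r c) m' n') (mulpc r (mulp r c) n' m')).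
      + unfold mulpc. ring.
      + rewrite !H, (delta_sym n' m'). ring. }
  apply Ceq_minus.
  apply (mulp_injective_on r (fun _ _ => True) (fun i j => Cminus (c i j) (c j i))); auto.
  - apply bounded2_sub_swap, Hb.
  - intros m' n' _. transitivity (Cminus (mulp r c m' n') (mulp r c n' m')).
    + unfold mulp. ring.
    + rewrite (Hv m' n'). ring.
Qed.

(* On the torus [1 - (z1 + 1/z1)/r = |p|^2 + conj z2 p / r + z2 conj p / r]. *)
Lemma weight_coefs_axis_rec (r : R) (c : Z -> Z -> C) (j : Z) : 2 < r -> weight_coefs r c ->
  Cminus (c j 0%Z) (Cmult (RtoC (/ r)) (Cplus (c (j + 1)%Z 0%Z) (c (j - 1)%Z 0%Z))) = delta j 0.
Proof.
  intros hr Hc. pose proof Hc as [_ [Hconj H]].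
  rewrite <- H. unfold mulpc.
  rewrite (mulp_weight_vanish r c j (0 - 1)) by (auto; lia).
  assert (Hu : Cconj (mulp r c (- j) (-1)) = RtoC 0).
  { rewrite mulp_weight_vanish by (auto; lia). apply injective_projections; simpl; ring. }
  (* Conjugation reflects the vanishing at [(-j, -1)] into a relation expressing [c j 1] through
     [c (j-1) 1] and [c j 0]; substituting it cancels all values in row [1]. *)
  assert (Hu' : Cconj (mulp r c (- j) (-1)) =
    Cminus (c j 1%Z) (Cmult (RtoC (/ r)) (Cplus (c (j - 1)%Z 1%Z) (c j 0%Z)))).
  { replace (c j 1%Z) with (Cconj (c (- j)%Z (-1)%Z)) by (rewrite <- Hconj; f_equal; lia).
    replace (c (j - 1)%Z 1%Z) with (Cconj (c (- j + 1)%Z (-1)%Z))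
      by (rewrite <- Hconj; f_equal; lia).
    replace (c j 0%Z) with (Cconj (c (- j)%Z 0%Z)) by (rewrite <- Hconj; f_equal; lia).
    unfold mulp. apply injective_projections; simpl; ring. }
  rewrite Hu in Hu'. unfold mulp.
  replace (j - 1 + 1)%Z with j by lia. change (0 + 1)%Z with 1%Z.
  assert (E : c j 1%Z = Cmult (RtoC (/ r)) (Cplus (c (j - 1)%Z 1%Z) (c j 0%Z)))
    by (apply Ceq_minus; symmetry; exact Hu').
  rewrite E. ring.
Qed.

(** [a] is the smaller root of [a^2 - r a + 1 = 0], the characteristic equation of the recurrence
    along the axis; the other root is [1/a]. *)
Lemma aa_props (r : R) : 2 < r -> 0 < aa r < 1 /\ aa r * r = 1 + aa r ^ 2.
Proof.
  intros hr. unfold aa.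
  assert (H0 : 0 < r ^ 2 / 4 - 1) by nra.
  pose proof (sqrt_lt_R0 _ H0) as Hs.
  pose proof (sqrt_sqrt _ (Rlt_le _ _ H0)) as Hss.
  set (s := sqrt (r ^ 2 / 4 - 1)) in *. split; [split |]; nra.
Qed.

Lemma RtoC_aa_mul (r : R) : 2 < r ->
  Cmult (RtoC (aa r)) (RtoC r) = Cplus (RtoC 1) (Cmult (RtoC (aa r)) (RtoC (aa r))).
Proof.
  intros hr. destruct (aa_props r hr) as [_ H].
  rewrite <- !RtoC_mult, <- RtoC_plus. f_equal. lra.
Qed.

(* The one-step differences obey [h_j = a h_(j-1)] away from [0], so boundedness as
   [j -> -oo] kills them for [j < 0]. *)
Lemma weight_coefs_axis_neg (r : R) (c : Z -> Z -> C) (j : Z) : 2 < r -> weight_coefs r c ->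
  (j < 0)%Z -> c j 0%Z = Cmult (RtoC (aa r)) (c (j + 1)%Z 0%Z).
Proof.
  intros hr Hc Hj. destruct (aa_props r hr) as [Ha Har]. apply Ceq_minus.
  (* The contraction runs toward [-oo] with rate [a]; the identity map, with weight [0], fills the
     second slot. *)
  apply (contraction_zero (fun j => (j < 0)%Z)
    (fun j => Cminus (c j 0%Z) (Cmult (RtoC (aa r)) (c (j + 1)%Z 0%Z)))
    (fun j => (j - 1)%Z) (fun j => j) (aa r) 0); try lra; auto.
  - pose proof Hc as [Hb _].
    destruct (bounded2_lin (RtoC (- aa r)) _ _ Hb
      (bounded2_reindex (fun m _ => (m + 1)%Z) (fun _ n => n) c Hb)) as [B HB].
    exists B. intros i. specialize (HB i 0%Z). rewrite RtoC_opp in HB.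
    eapply Rle_trans; [| exact HB]. apply Req_le. f_equal. ring.
  - intros i Hi. lia.
  - intros i Hi.
    pose proof (weight_coefs_axis_rec r c i hr Hc) as H.
    rewrite delta_neq in H by lia. replace (i - 1 + 1)%Z with i by lia.
    assert (Hr : Cmult (RtoC r) (RtoC (/ r)) = RtoC 1)
      by (rewrite <- RtoC_mult; f_equal; field; lra).
    (* The difference of the two sides is [a r] times the axis recurrence at [i], once [1 + a^2] is
       rewritten as [a r]. *)
    apply Ceq_minus.
    transitivity (Cmult (Cmult (RtoC (aa r)) (RtoC r))
      (Cminus (c i 0%Z) (Cmult (RtoC (/ r)) (Cplus (c (i + 1)%Z 0%Z) (c (i - 1)%Z 0%Z))))).
    2: rewrite H; ring.
    transitivity (Cminus (Cmult (Cplus (RtoC 1) (Cmult (RtoC (aa r)) (RtoC (aa r)))) (c i 0%Z))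
       (Cmult (RtoC (aa r)) (Cplus (c (i + 1)%Z 0%Z) (c (i - 1)%Z 0%Z)))); [ring |].
    rewrite <- RtoC_aa_mul by exact hr.
    transitivity (Cminus (Cmult (Cmult (RtoC (aa r)) (RtoC r)) (c i 0%Z))
       (Cmult (Cmult (RtoC (aa r)) (RtoC 1)) (Cplus (c (i + 1)%Z 0%Z) (c (i - 1)%Z 0%Z))));
      [ring |].
    rewrite <- Hr. ring.
Qed.

(** The relation on the negative half-axis is reflected by conjugation, which leaves the real number
    [a] fixed. *)
Lemma weight_coefs_axis_pos (r : R) (c : Z -> Z -> C) (j : Z) : 2 < r -> weight_coefs r c ->
  (0 <= j)%Z -> c (j + 1)%Z 0%Z = Cmult (RtoC (aa r)) (c j 0%Z).
Proof.
  intros hr Hc Hj. pose proof Hc as [_ [Hconj _]].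
  replace (c (j + 1)%Z 0%Z) with (Cconj (c (- (j + 1))%Z 0%Z))
    by (rewrite <- Hconj; f_equal; lia).
  rewrite (weight_coefs_axis_neg r) by (auto; lia).
  replace (c j 0%Z) with (Cconj (c (- j)%Z 0%Z)) by (rewrite <- Hconj; f_equal; lia).
  replace (- (j + 1) + 1)%Z with (- j)%Z by lia.
  apply injective_projections; simpl; ring.
Qed.

(** At [0] both neighbours in the axis recurrence equal [a c 0 0], so [(1 - 2a/r) c 0 0 = 1];
    multiplying by [a r = 1 + a^2] turns the factor into [1 - a^2]. *)
Lemma weight_coefs_origin (r : R) (c : Z -> Z -> C) : 2 < r -> weight_coefs r c ->
  Cmult (RtoC (1 - aa r ^ 2)) (c 0%Z 0%Z) = RtoC (aa r * r).
Proof.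
  intros hr Hc. destruct (aa_props r hr) as [Ha Har].
  pose proof (weight_coefs_axis_rec r c 0 hr Hc) as H.
  change (delta 0 0) with (RtoC 1) in H.
  rewrite (weight_coefs_axis_neg r c (0 - 1)), (weight_coefs_axis_pos r c 0) in H by (auto; lia).
  change (0 - 1 + 1)%Z with 0%Z in H.
  rewrite RtoC_mult.
  transitivity (Cmult (Cmult (RtoC (aa r)) (RtoC r)) (RtoC 1)); [| ring].
  rewrite <- H.
  replace (1 - aa r ^ 2) with (aa r * r - aa r * r * / r * (aa r + aa r)).
  - rewrite RtoC_minus, !RtoC_mult, RtoC_plus. ring.
  - field_simplify; [| lra]. nra.
Qed.

(** Induction on the row. Let [d k] be the defect of the relation in row [-(l+1)]. Combining
    [mulp_weight_vanish] at [k] and [k + 1], the contribution of row [-l] cancels by induction,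
    leaving [d k = (1/r) d (k+1)]; boundedness as [k -> oo] forces [d = 0]. *)
Lemma weight_coefs_quadrant (r : R) (c : Z -> Z -> C) (k l : nat) : 2 < r -> weight_coefs r c ->
  c (Z.of_nat k + 1)%Z (- Z.of_nat l)%Z = Cmult (RtoC (aa r)) (c (Z.of_nat k) (- Z.of_nat l)%Z).
Proof.
  intros hr Hc. destruct (contraction_rate r hr) as [h1 h2].
  revert k. induction l as [| l IH]; intros k.
  - change (- Z.of_nat 0)%Z with 0%Z. apply weight_coefs_axis_pos; auto; lia.
  - apply Ceq_minus.
    apply (contraction_zero (fun _ : nat => True)
      (fun k => Cminus (c (Z.of_nat k + 1)%Z (- Z.of_nat (S l))%Z)
         (Cmult (RtoC (aa r)) (c (Z.of_nat k) (- Z.of_nat (S l))%Z)))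
      S (fun k => k) (/ r) 0); try lra; auto.
    + pose proof Hc as [Hb _].
      destruct (bounded2_lin (RtoC (- aa r)) _ _
        (bounded2_reindex (fun m _ => (m + 1)%Z) (fun _ n => n) c Hb) Hb) as [B HB].
      exists B. intros i. specialize (HB (Z.of_nat i) (- Z.of_nat (S l))%Z).
      rewrite RtoC_opp in HB.
      eapply Rle_trans; [| exact HB]. apply Req_le. f_equal. ring.
    + intros i _.
      pose proof (mulp_weight_vanish r c (Z.of_nat i) (- Z.of_nat (S l)) hr Hc) as H1.
      pose proof (mulp_weight_vanish r c (Z.of_nat i + 1) (- Z.of_nat (S l)) hr Hc) as H2.
      unfold mulp in H1, H2.
      replace (- Z.of_nat (S l) + 1)%Z with (- Z.of_nat l)%Z in H1, H2 by lia.
      replace (Z.of_nat (S i)) with (Z.of_nat i + 1)%Z by lia.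
      rewrite IH in H2.
      specialize (H1 ltac:(lia)). specialize (H2 ltac:(lia)).
      apply Ceq_minus.
      match type of H1 with ?A1 = _ => match type of H2 with ?A2 = _ =>
        transitivity (Cminus A2 (Cmult (RtoC (aa r)) A1)); [ring |] end end.
      rewrite H1, H2. ring.
Qed.

(** * Exponentials, Laurent monomials and their means *)

Lemma eit_plus (s t : R) : eit (s + t) = Cmult (eit s) (eit t).
Proof.
  unfold eit. rewrite cos_plus, sin_plus. apply injective_projections; simpl; ring.
Qed.

Lemma eit_opp (t : R) : eit (- t) = Cconj (eit t).
Proof. unfold eit. now rewrite cos_neg, sin_neg. Qed.

Lemma eit_0 : eit 0 = RtoC 1.
Proof. unfold eit. now rewrite cos_0, sin_0. Qed.

Lemma Cmod_eit (t : R) : Cmod (eit t) = 1.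
Proof.
  unfold Cmod, eit. simpl fst; simpl snd. rewrite <- sqrt_1. f_equal.
  pose proof (sin2_cos2 t) as H. unfold Rsqr in H. lra.
Qed.

Lemma eit_2PI (t : R) (n : Z) : eit (t + IZR n * (2 * PI)) = eit t.
Proof.
  assert (Hn : forall s (k : nat), eit (s + INR k * (2 * PI)) = eit s).
  { intros s k. unfold eit. replace (s + INR k * (2 * PI)) with (s + 2 * INR k * PI) by ring.
    now rewrite cos_period, sin_period. }
  destruct (Z_le_gt_dec 0 n) as [H | H].
  - rewrite <- (Z2Nat.id n H), <- INR_IZR_INZ. apply Hn.
  - rewrite <- (Hn _ (Z.to_nat (- n))). f_equal.
    rewrite INR_IZR_INZ, Z2Nat.id, opp_IZR by lia. ring.
Qed.

(** The pair [(0, k)] is the complex number [i k]. Keeping this factor in the integrand avoids a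
    division and makes the integrand the derivative of [eit (t + k y)]. *)
Lemma is_RInt_eit (t k a b : R) :
  is_RInt (V := C_R_NormedModule) (fun y => Cmult (0, k) (eit (t + k * y))) a b
    (Cminus (eit (t + k * b)) (eit (t + k * a))).
Proof.
  apply (is_RInt_fct_extend_pair (U := R_NormedModule) (V := R_NormedModule)).
  - apply (is_RInt_derive (V := R_CompleteNormedModule) (fun y => cos (t + k * y))).
    + intros x _. simpl. auto_derive; [trivial | ring].
    + intros x _. simpl. apply (ex_derive_continuous (V := R_NormedModule)).
      auto_derive. trivial.
  - apply (is_RInt_derive (V := R_CompleteNormedModule) (fun y => sin (t + k * y))).
    + intros x _. simpl. auto_derive; [trivial | ring].
    + intros x _. simpl. apply (ex_derive_continuous (V := R_NormedModule)).
      auto_derive. trivial.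
Qed.

(** A chord is the integral of the unit-modulus velocity along its arc. *)
Lemma eit_lipschitz (s t : R) : Cmod (Cminus (eit s) (eit t)) <= Rabs (s - t).
Proof.
  assert (H : forall u v, u <= v -> Cmod (Cminus (eit v) (eit u)) <= v - u).
  { intros u v Huv. pose proof (is_RInt_eit 0 1 u v) as H.
    rewrite !Rplus_0_l, !Rmult_1_l in H.
    rewrite <- (Rmult_1_r (v - u)). apply Cmod_is_RInt_le with (3 := H); [exact Huv |].
    intros y. rewrite Cmod_mult, Cmod_eit. apply Req_le.
    rewrite Rmult_1_r. transitivity (sqrt 1); [| apply sqrt_1]. unfold Cmod. f_equal. simpl. ring. }
  destruct (Rle_lt_dec s t) as [Hst | Hst].
  - rewrite Rabs_minus_sym, Rabs_pos_eq by lra.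
    rewrite <- Cmod_opp.
    replace (Copp (Cminus (eit s) (eit t))) with (Cminus (eit t) (eit s)) by ring.
    apply H, Hst.
  - rewrite Rabs_pos_eq by lra. apply H. lra.
Qed.

(** The phase [t] stands for the contribution of the outer variable, frozen during the inner
    integration. *)
Lemma is_RInt_circle (t : R) (n : Z) :
  is_RInt (V := C_R_NormedModule) (fun y => eit (t + IZR n * y)) 0 (2 * PI)
    (if Z.eqb n 0 then Cmult (RtoC (2 * PI)) (eit t) else RtoC 0).
Proof.
  destruct (Z.eqb_spec n 0) as [-> | Hn].
  - apply (is_RInt_ext (V := C_R_NormedModule) (fun _ => eit t)).
    { intros y _. f_equal. ring. }
    replace (Cmult (RtoC (2 * PI)) (eit t))
      with (scal (V := C_R_NormedModule) (2 * PI - 0) (eit t)).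
    + apply (is_RInt_const (V := C_R_NormedModule)).
    + apply injective_projections; simpl; unfold scal; simpl; unfold mult; simpl; ring.
  - assert (Hk : (0, IZR n) <> RtoC 0).
    { intros E. injection E. apply not_0_IZR, Hn. }
    apply (is_RInt_ext (V := C_R_NormedModule)
      (fun y => Cmult (Cinv (0, IZR n)) (Cmult (0, IZR n) (eit (t + IZR n * y))))).
    { intros y _. rewrite Cmult_assoc, Cinv_l, Cmult_1_l by exact Hk. reflexivity. }
    replace (RtoC 0) with (Cmult (Cinv (0, IZR n))
      (Cminus (eit (t + IZR n * (2 * PI))) (eit (t + IZR n * 0)))).
    + apply is_RInt_Cmult, is_RInt_eit.
    + rewrite eit_2PI, Rmult_0_r, Rplus_0_r. ring.
Qed.

Definition mono (m n : Z) (x y : R) : C := eit (IZR m * x + IZR n * y).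

Lemma mono_mult (m n m' n' : Z) (x y : R) :
  Cmult (mono m n x y) (mono m' n' x y) = mono (m + m') (n + n') x y.
Proof. unfold mono. rewrite <- eit_plus, !plus_IZR. f_equal. ring. Qed.

Lemma mono_conj (m n : Z) (x y : R) : Cconj (mono m n x y) = mono (- m) (- n) x y.
Proof. unfold mono. rewrite <- eit_opp, !opp_IZR. f_equal. ring. Qed.

Lemma bounded_lip_mono (m n : Z) : bounded_lip (mono m n).
Proof.
  split.
  - exists 1. intros x y. unfold mono. rewrite Cmod_eit. lra.
  - exists (Rabs (IZR m) + Rabs (IZR n)). intros x y x' y'. unfold mono.
    eapply Rle_trans; [apply eit_lipschitz |].
    replace (IZR m * x + IZR n * y - (IZR m * x' + IZR n * y'))
      with (IZR m * (x - x') + IZR n * (y - y')) by ring.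
    eapply Rle_trans; [apply Rabs_triang |]. rewrite !Rabs_mult.
    pose proof (Rabs_pos (IZR m)). pose proof (Rabs_pos (IZR n)).
    pose proof (Rabs_pos (x - x')). pose proof (Rabs_pos (y - y')). nra.
Qed.

Lemma mean_mono (m n : Z) : mean (mono m n) = delta m n.
Proof.
  pose proof PI_RGT_0 as Hpi.
  assert (Hin : forall x, is_RInt (V := C_R_NormedModule) (fun y => mono m n x y) 0 (2 * PI)
    (Cmult (if Z.eqb n 0 then RtoC (2 * PI) else RtoC 0) (eit (0 + IZR m * x)))).
  { intros x. pose proof (is_RInt_circle (IZR m * x) n) as H. rewrite Rplus_0_l.
    destruct (Z.eqb n 0); [exact H |]. rewrite Cmult_0_l. exact H. }
  etransitivity; [exact (mean_of_iterated _ _ _ Hin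
    (is_RInt_Cmult _ _ _ _ _ (is_RInt_circle 0 m))) |].
  unfold delta. destruct (Z.eqb m 0), (Z.eqb n 0); simpl; try ring.
  rewrite eit_0, <- !RtoC_mult. f_equal. field. lra.
Qed.

(** * Moments of the weight [1 / |p|^2] *)

(** The index has the opposite sign to the usual Fourier convention: multiplying [G] by [z1] raises
    [m] by one. *)
Definition fourier_coef (G : R -> R -> C) (m n : Z) : C :=
  mean (fun x y => Cmult (mono m n x y) (G x y)).

Definition p_torus (r : R) (x y : R) : C := pr r (eit x) (eit y).

Lemma mono_1_0 (x y : R) : eit x = mono 1 0 x y.
Proof. unfold mono. f_equal. ring. Qed.

Lemma mono_0_1 (x y : R) : eit y = mono 0 1 x y.
Proof. unfold mono. f_equal. ring. Qed.

Lemma p_torus_mono (r x y : R) : r <> 0 ->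
  p_torus r x y = Cminus (RtoC 1) (Cmult (RtoC (/ r)) (Cplus (mono 1 0 x y) (mono 0 1 x y))).
Proof.
  intros hr. unfold p_torus, pr. rewrite <- mono_1_0, <- mono_0_1, RtoC_inv by exact hr.
  unfold Cdiv. ring.
Qed.

Lemma p_torus_conj_mono (r x y : R) : r <> 0 ->
  Cconj (p_torus r x y) =
  Cminus (RtoC 1) (Cmult (RtoC (/ r)) (Cplus (mono (-1) 0 x y) (mono 0 (-1) x y))).
Proof.
  intros hr. rewrite p_torus_mono by exact hr.
  change (mono (-1) 0 x y) with (mono (- (1)) (- (0)) x y).
  change (mono 0 (-1) x y) with (mono (- (0)) (- (1)) x y).
  rewrite <- !mono_conj. apply injective_projections; simpl; ring.
Qed.

Lemma bounded_lip_p_torus (r : R) : r <> 0 -> bounded_lip (p_torus r).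
Proof.
  intros hr.
  assert (H : bounded_lip (fun x y => Cplus (RtoC 1)
    (Cmult (RtoC (- / r)) (Cplus (mono 1 0 x y) (mono 0 1 x y))))).
  { apply bounded_lip_plus; [apply bounded_lip_const |].
    apply bounded_lip_mult; [apply bounded_lip_const |].
    apply bounded_lip_plus; apply bounded_lip_mono. }
  destruct H as [[B HB] [L HL]].
  assert (E : forall x y, p_torus r x y = Cplus (RtoC 1)
    (Cmult (RtoC (- / r)) (Cplus (mono 1 0 x y) (mono 0 1 x y)))).
  { intros x y. rewrite p_torus_mono, RtoC_opp by exact hr. ring. }
  split; [exists B | exists L]; intros; rewrite !E; auto.
Qed.

(** Triangle inequality for [1 = p + (z1 + z2)/r], with [|z1 + z2| <= 2]. *)
Lemma Cmod_p_torus_ge (r x y : R) : 2 < r -> 1 - 2 / r <= Cmod (p_torus r x y).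
Proof.
  intros hr. rewrite p_torus_mono by lra.
  pose proof (Cmod_triangle
    (Cminus (RtoC 1) (Cmult (RtoC (/ r)) (Cplus (mono 1 0 x y) (mono 0 1 x y))))
    (Cmult (RtoC (/ r)) (Cplus (mono 1 0 x y) (mono 0 1 x y)))) as H.
  rewrite (Cmod_mult (RtoC (/ r))), Cmod_R in H.
  pose proof (Cmod_triangle (mono 1 0 x y) (mono 0 1 x y)) as H2.
  unfold mono at 3 4 in H2. rewrite !Cmod_eit in H2.
  assert (Hr : 0 < / r) by (apply Rinv_0_lt_compat; lra).
  rewrite (Rabs_pos_eq (/ r)) in H by lra.
  replace (Cplus (Cminus (RtoC 1) (Cmult (RtoC (/ r)) (Cplus (mono 1 0 x y) (mono 0 1 x y))))
    (Cmult (RtoC (/ r)) (Cplus (mono 1 0 x y) (mono 0 1 x y)))) with (RtoC 1) in H by ring.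
  rewrite Cmod_1 in H. unfold Rdiv. nra.
Qed.

Definition weight (r : R) (x y : R) : C := Cinv (RtoC (Cmod (p_torus r x y) ^ 2)).

Lemma p_torus_gap (r : R) : 2 < r -> 0 < 1 - 2 / r.
Proof.
  intros hr. apply Rlt_0_minus, (Rmult_lt_reg_r r); [lra |].
  unfold Rdiv. rewrite Rmult_assoc, Rinv_l by lra. lra.
Qed.

Lemma p_torus_neq_0 (r x y : R) : 2 < r -> p_torus r x y <> RtoC 0.
Proof.
  intros hr. apply Cmod_gt_0.
  eapply Rlt_le_trans; [apply (p_torus_gap r hr) | apply Cmod_p_torus_ge, hr].
Qed.

Lemma bounded_lip_weight (r : R) : 2 < r -> bounded_lip (weight r).
Proof.
  intros hr. pose proof (p_torus_gap r hr) as Hg.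
  assert (H : bounded_lip (fun x y => Cinv (Cmult (p_torus r x y) (Cconj (p_torus r x y))))).
  { apply bounded_lip_inv with (d := (1 - 2 / r) * (1 - 2 / r)).
    - apply Rmult_lt_0_compat; assumption.
    - intros x y. rewrite Cmod_mult, Cmod_conj.
      apply Rmult_le_compat; try lra; apply Cmod_p_torus_ge, hr.
    - apply bounded_lip_mult; [| apply bounded_lip_conj]; apply bounded_lip_p_torus; lra. }
  destruct H as [[B HB] [L HL]].
  split; [exists B | exists L]; intros; unfold weight; rewrite !Cmod2_conj; auto.
Qed.

Lemma weight_conj (r x y : R) : Cconj (weight r x y) = weight r x y.
Proof.
  unfold weight. apply injective_projections; simpl; [reflexivity |].
  unfold Rdiv. ring.
Qed.

Lemma fourier_coef_bounded (G : R -> R -> C) : bounded_lip G -> bounded2 (fourier_coef G).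
Proof.
  intros HG. pose proof HG as [[B HB] _]. exists B. intros m n. apply Cmod_mean_le.
  - apply bounded_lip_mult; [apply bounded_lip_mono | exact HG].
  - intros x y. rewrite Cmod_mult. unfold mono. rewrite Cmod_eit, Rmult_1_l. apply HB.
Qed.

Lemma bounded_lip_mono_mult (m n : Z) (G : R -> R -> C) : bounded_lip G ->
  bounded_lip (fun x y => Cmult (mono m n x y) (G x y)).
Proof. intros HG. apply bounded_lip_mult; [apply bounded_lip_mono | exact HG]. Qed.

Lemma fourier_coef_lin3 (k : C) (G : R -> R -> C) (m n m1 n1 m2 n2 : Z) : bounded_lip G ->
  mean (fun x y => Cplus (Cmult (mono m n x y) (G x y))
    (Cmult k (Cplus (Cmult (mono m1 n1 x y) (G x y)) (Cmult (mono m2 n2 x y) (G x y))))) =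
  Cplus (fourier_coef G m n) (Cmult k (Cplus (fourier_coef G m1 n1) (fourier_coef G m2 n2))).
Proof.
  intros HG.
  assert (H12 : bounded_lip (fun x y =>
    Cplus (Cmult (mono m1 n1 x y) (G x y)) (Cmult (mono m2 n2 x y) (G x y))))
    by (apply bounded_lip_plus; apply bounded_lip_mono_mult; exact HG).
  rewrite mean_plus; [| apply bounded_lip_mono_mult; exact HG |
    apply bounded_lip_mult; [apply bounded_lip_const | exact H12]].
  rewrite mean_scal by exact H12.
  rewrite mean_plus by (apply bounded_lip_mono_mult; exact HG). reflexivity.
Qed.

Lemma fourier_coef_p_torus (r : R) (G : R -> R -> C) (m n : Z) : r <> 0 -> bounded_lip G ->
  fourier_coef (fun x y => Cmult (p_torus r x y) (G x y)) m n = mulp r (fourier_coef G) m n.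
Proof.
  intros hr HG. unfold mulp.
  transitivity (Cplus (fourier_coef G m n) (Cmult (RtoC (- / r))
    (Cplus (fourier_coef G (m + 1) n) (fourier_coef G m (n + 1))))).
  - rewrite <- fourier_coef_lin3 by exact HG. apply mean_ext. intros x y.
    rewrite p_torus_mono, RtoC_opp by exact hr.
    replace (mono (m + 1) n x y) with (Cmult (mono m n x y) (mono 1 0 x y))
      by (rewrite mono_mult; f_equal; lia).
    replace (mono m (n + 1) x y) with (Cmult (mono m n x y) (mono 0 1 x y))
      by (rewrite mono_mult; f_equal; lia).
    ring.
  - rewrite RtoC_opp. ring.
Qed.

Lemma fourier_coef_p_torus_conj (r : R) (G : R -> R -> C) (m n : Z) : r <> 0 -> bounded_lip G ->
  fourier_coef (fun x y => Cmult (Cconj (p_torus r x y)) (G x y)) m n = mulpc r (fourier_coef G) m n.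
Proof.
  intros hr HG. unfold mulpc.
  transitivity (Cplus (fourier_coef G m n) (Cmult (RtoC (- / r))
    (Cplus (fourier_coef G (m - 1) n) (fourier_coef G m (n - 1))))).
  - rewrite <- fourier_coef_lin3 by exact HG. apply mean_ext. intros x y.
    rewrite p_torus_conj_mono, RtoC_opp by exact hr.
    replace (mono (m - 1) n x y) with (Cmult (mono m n x y) (mono (-1) 0 x y))
      by (rewrite mono_mult; f_equal; lia).
    replace (mono m (n - 1) x y) with (Cmult (mono m n x y) (mono 0 (-1) x y))
      by (rewrite mono_mult; f_equal; lia).
    ring.
  - rewrite RtoC_opp. ring.
Qed.

(** The abstract moment theory applies: the conjugation rule holds because the weight is real, and
    the last clause because [conj p * p * weight = 1] reduces it to the means of monomials. *)
Lemma weight_coefs_weight (r : R) : 2 < r -> weight_coefs r (fourier_coef (weight r)).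
Proof.
  intros hr. pose proof (bounded_lip_weight r hr) as Hw.
  assert (hr0 : r <> 0) by lra.
  split; [apply fourier_coef_bounded, Hw | split].
  - intros m n. unfold fourier_coef. rewrite <- mean_conj by (apply bounded_lip_mono_mult; exact Hw).
    apply mean_ext. intros x y. rewrite Cmult_conj, weight_conj, mono_conj. reflexivity.
  - intros m n. rewrite <- mean_mono.
    transitivity (mulpc r (fourier_coef (fun x y => Cmult (p_torus r x y) (weight r x y))) m n).
    { unfold mulpc. rewrite !fourier_coef_p_torus by assumption. reflexivity. }
    rewrite <- fourier_coef_p_torus_conj;
      [| exact hr0 | apply bounded_lip_mult; [apply bounded_lip_p_torus, hr0 | exact Hw]].
    apply mean_ext. intros x y. unfold weight. rewrite Cmod2_conj.
    pose proof (p_torus_neq_0 r x y hr) as Hp.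
    field. split; [| exact Hp].
    intros E. apply Hp. rewrite <- (Cconj_conj (p_torus r x y)), E.
    apply injective_projections; simpl; ring.
Qed.

(** * The Hermitian form on monomials and on the building blocks of the family *)

Definition form (r : R) (F G : R -> R -> C) : C :=
  mean (fun x y => Cmult (Cmult (F x y) (Cconj (G x y))) (weight r x y)).

Lemma inner_form (r : R) (g h : C -> C -> C) (F G : R -> R -> C) :
  (forall x y, g (eit x) (eit y) = F x y) -> (forall x y, h (eit x) (eit y) = G x y) ->
  inner r g h = form r F G.
Proof.
  intros HF HG.
  transitivity (form r (fun x y => g (eit x) (eit y)) (fun x y => h (eit x) (eit y))).
  (* Division by [|p|^2] unfolds to multiplication by [weight]. *)
  - reflexivity.
  - apply mean_ext. intros x y. now rewrite HF, HG.
Qed.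

Lemma bounded_lip_form (r : R) (F G : R -> R -> C) : 2 < r -> bounded_lip F -> bounded_lip G ->
  bounded_lip (fun x y => Cmult (Cmult (F x y) (Cconj (G x y))) (weight r x y)).
Proof. auto using bounded_lip_mult, bounded_lip_conj, bounded_lip_weight. Qed.

Lemma form_conj (r : R) (F G : R -> R -> C) : 2 < r -> bounded_lip F -> bounded_lip G ->
  form r G F = Cconj (form r F G).
Proof.
  intros hr HF HG. unfold form. rewrite <- mean_conj by (apply bounded_lip_form; assumption).
  apply mean_ext. intros x y. rewrite !Cmult_conj, Cconj_conj, weight_conj. ring.
Qed.

Lemma form_lin_l (r : R) (k : C) (F F' G : R -> R -> C) : 2 < r ->
  bounded_lip F -> bounded_lip F' -> bounded_lip G ->
  form r (fun x y => Cplus (F x y) (Cmult k (F' x y))) G =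
  Cplus (form r F G) (Cmult k (form r F' G)).
Proof.
  intros hr HF HF' HG. unfold form.
  pose proof (bounded_lip_form r F G hr HF HG) as H.
  pose proof (bounded_lip_form r F' G hr HF' HG) as H'.
  rewrite <- mean_scal by exact H'.
  rewrite <- mean_plus; [| exact H | apply bounded_lip_mult; [apply bounded_lip_const | exact H']].
  apply mean_ext. intros x y. ring.
Qed.

Lemma form_scal_l (r : R) (k : C) (F G : R -> R -> C) : 2 < r -> bounded_lip F -> bounded_lip G ->
  form r (fun x y => Cmult k (F x y)) G = Cmult k (form r F G).
Proof.
  intros hr HF HG. unfold form.
  rewrite <- mean_scal by (apply bounded_lip_form; assumption).
  apply mean_ext. intros x y. ring.
Qed.

Lemma form_mono (r : R) (m n m' n' : Z) :
  form r (mono m n) (mono m' n') = fourier_coef (weight r) (m - m') (n - n').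
Proof.
  apply mean_ext. intros x y. now rewrite mono_conj, mono_mult.
Qed.

(** One shape serves the constant (with [k = 0]), the members [z^k (z - a)] up to scaling, and the
    sum of the two lower terms of [reflected_p]. *)
Definition two_terms (s k : R) (m n m' n' : Z) (x y : R) : C :=
  Cmult (RtoC s) (Cplus (mono m n x y) (Cmult (RtoC k) (mono m' n' x y))).

(* [z1^k z2^l] times the reflected polynomial [z1 z2 conj p]. *)
Definition reflected_p (r : R) (k l : Z) (x y : R) : C :=
  Cplus (mono (k + 1) (l + 1) x y)
    (Cmult (RtoC (- / r)) (two_terms 1 1 k (l + 1) (k + 1) l x y)).

Lemma bounded_lip_two_terms (s k : R) (m n m' n' : Z) : bounded_lip (two_terms s k m n m' n').
Proof.
  apply bounded_lip_mult; [apply bounded_lip_const |].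
  apply bounded_lip_plus; [apply bounded_lip_mono |].
  apply bounded_lip_mult; [apply bounded_lip_const | apply bounded_lip_mono].
Qed.

Lemma bounded_lip_reflected_p (r : R) (k l : Z) : bounded_lip (reflected_p r k l).
Proof.
  apply bounded_lip_plus; [apply bounded_lip_mono |].
  apply bounded_lip_mult; [apply bounded_lip_const | apply bounded_lip_two_terms].
Qed.

Lemma form_two_terms_l (r s k : R) (m n m' n' : Z) (G : R -> R -> C) : 2 < r -> bounded_lip G ->
  form r (two_terms s k m n m' n') G =
  Cmult (RtoC s) (Cplus (form r (mono m n) G) (Cmult (RtoC k) (form r (mono m' n') G))).
Proof.
  intros hr HG. pose proof (bounded_lip_mono m n). pose proof (bounded_lip_mono m' n').
  rewrite <- form_lin_l, <- form_scal_l; auto.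
  apply bounded_lip_plus; auto. apply bounded_lip_mult; auto. apply bounded_lip_const.
Qed.

Lemma form_reflected_p_l (r : R) (k l : Z) (G : R -> R -> C) : 2 < r -> bounded_lip G ->
  form r (reflected_p r k l) G =
  Cminus (form r (mono (k + 1) (l + 1)) G)
    (Cmult (RtoC (/ r)) (Cplus (form r (mono k (l + 1)) G) (form r (mono (k + 1) l) G))).
Proof.
  intros hr HG.
  transitivity (Cplus (form r (mono (k + 1) (l + 1)) G)
    (Cmult (RtoC (- / r)) (form r (two_terms 1 1 k (l + 1) (k + 1) l) G))).
  - rewrite <- form_lin_l; auto using bounded_lip_mono, bounded_lip_two_terms.
  - rewrite form_two_terms_l, RtoC_opp by assumption. ring.
Qed.

Lemma form_two_terms_two_terms (r s k s' k' : R) (m n m' n' p q p' q' : Z) : 2 < r ->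
  let c := fourier_coef (weight r) in
  form r (two_terms s k m n m' n') (two_terms s' k' p q p' q') =
  Cmult (Cmult (RtoC s) (RtoC s'))
    (Cplus (Cplus (c (m - p)%Z (n - q)%Z) (Cmult (RtoC k') (c (m - p')%Z (n - q')%Z)))
       (Cmult (RtoC k)
         (Cplus (c (m' - p)%Z (n' - q)%Z) (Cmult (RtoC k') (c (m' - p')%Z (n' - q')%Z))))).
Proof.
  intros hr c.
  (* The second argument is expanded by swapping the arguments through [form_conj]; the scalars are
     real, so conjugation leaves them unchanged. *)
  assert (Hr : forall i j, form r (mono i j) (two_terms s' k' p q p' q') =
    Cmult (RtoC s') (Cplus (c (i - p)%Z (j - q)%Z) (Cmult (RtoC k') (c (i - p')%Z (j - q')%Z)))).
  { intros i j. pose proof (bounded_lip_mono i j).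
    rewrite form_conj, form_two_terms_l by auto using bounded_lip_two_terms.
    rewrite Cmult_conj, Cplus_conj, Cmult_conj, <- !form_conj by auto using bounded_lip_mono.
    unfold c. rewrite <- !form_mono. apply injective_projections; simpl; ring. }
  rewrite form_two_terms_l, !Hr by auto using bounded_lip_two_terms. ring.
Qed.

(** On the torus the second argument is [z1^(k+1) z2^(l+1) conj p], so conjugating it puts a factor
    [p] and the inverse monomial under the mean. *)
Lemma form_mono_reflected_p (r : R) (m n k l : Z) : 2 < r ->
  form r (mono m n) (reflected_p r k l) = mulp r (fourier_coef (weight r)) (m - k - 1) (n - l - 1).
Proof.
  intros hr. rewrite form_conj, form_reflected_p_l by auto using bounded_lip_mono, bounded_lip_reflected_p.
  unfold mulp.
  rewrite Cminus_conj, Cmult_conj, Cplus_conj, <- !form_conj, !form_mono by auto using bounded_lip_mono.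
  replace (m - k - 1)%Z with (m - (k + 1))%Z by lia.
  replace (n - l - 1)%Z with (n - (l + 1))%Z by lia.
  replace (m - (k + 1) + 1)%Z with (m - k)%Z by lia.
  replace (n - (l + 1) + 1)%Z with (n - l)%Z by lia.
  apply injective_projections; simpl; ring.
Qed.

(** The left argument contributes [conj p] and the right one [p]; together they cancel the weight
    and leave the mean of a monomial. *)
Lemma form_reflected_p_reflected_p (r : R) (k l k' l' : Z) : 2 < r ->
  form r (reflected_p r k l) (reflected_p r k' l') = delta (k - k') (l - l').
Proof.
  intros hr. pose proof (weight_coefs_weight r hr) as [_ [_ H]].
  rewrite form_reflected_p_l, !form_mono_reflected_p by auto using bounded_lip_reflected_p.
  rewrite <- H. unfold mulpc.
  replace (k + 1 - k' - 1)%Z with (k - k')%Z by lia.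
  replace (l + 1 - l' - 1)%Z with (l - l')%Z by lia.
  reflexivity.
Qed.

(** Under the index conditions each monomial produces a moment of [p / |p|^2] with a negative
    index. *)
Lemma form_two_terms_reflected_p (r s a : R) (m n m' n' k l : Z) : 2 < r ->
  (m <= k \/ n <= l)%Z -> (m' <= k \/ n' <= l)%Z ->
  form r (two_terms s a m n m' n') (reflected_p r k l) = RtoC 0.
Proof.
  intros hr H1 H2. pose proof (weight_coefs_weight r hr) as Hc.
  rewrite form_two_terms_l, !form_mono_reflected_p by auto using bounded_lip_reflected_p.
  rewrite !mulp_weight_vanish by (auto; lia). ring.
Qed.

(** This combination arises from pairing [z^k (z - a)] with [z^l (z - a)], where [j = k - l]. It
    equals [(1 + a^2) c j 0 - a (c (j+1) 0 + c (j-1) 0)], which is [a r] times the axis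
    recurrence. *)
Lemma weight_coefs_axis_pair (r : R) (c : Z -> Z -> C) (j : Z) : 2 < r -> weight_coefs r c ->
  Cplus (Cplus (c j 0%Z) (Cmult (RtoC (- aa r)) (c (j + 1)%Z 0%Z)))
    (Cmult (RtoC (- aa r)) (Cplus (c (j - 1)%Z 0%Z) (Cmult (RtoC (- aa r)) (c j 0%Z)))) =
  Cmult (RtoC (aa r * r)) (delta j 0).
Proof.
  intros hr Hc. rewrite <- (weight_coefs_axis_rec r c j hr Hc), RtoC_mult, !RtoC_opp.
  assert (Hr : Cmult (RtoC r) (RtoC (/ r)) = RtoC 1)
    by (rewrite <- RtoC_mult; f_equal; field; lra).
  transitivity (Cminus (Cmult (Cplus (RtoC 1) (Cmult (RtoC (aa r)) (RtoC (aa r)))) (c j 0%Z))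
    (Cmult (Cmult (RtoC (aa r)) (RtoC 1)) (Cplus (c (j + 1)%Z 0%Z) (c (j - 1)%Z 0%Z)))); [ring |].
  rewrite <- RtoC_aa_mul, <- Hr by exact hr. ring.
Qed.

(** * The normalising constants *)

(** With [a r = 1 + a^2], the identity [(1 + a^2)^2 - 4 a^2 = (1 - a^2)^2] makes [1 - 4/r^2] a
    perfect square. *)
Lemma q4_sqr (r : R) : 2 < r -> q4 r * q4 r = (1 - aa r ^ 2) / (aa r * r).
Proof.
  intros hr. destruct (aa_props r hr) as [Ha Har].
  assert (H0 : 0 < aa r * r) by (rewrite Har; nra).
  unfold q4. rewrite sqrt_sqrt by apply sqrt_pos.
  assert (Hq : (1 - aa r ^ 2) / (aa r * r) * ((1 - aa r ^ 2) / (aa r * r)) = 1 - 4 / r ^ 2).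
  { replace ((1 - aa r ^ 2) / (aa r * r) * ((1 - aa r ^ 2) / (aa r * r)))
      with (((aa r * r) * (aa r * r) - 4 * aa r ^ 2) / (aa r * r * (aa r * r))).
    - field. lra.
    - rewrite !Har. field. nra. }
  apply sqrt_lem_1.
  - rewrite <- Hq. apply Rle_0_sqr.
  - apply Rmult_le_pos; [nra | left; apply Rinv_0_lt_compat, H0].
  - exact Hq.
Qed.

Definition lin_norm (r : R) : R := q4 r / sqrt (1 - aa r ^ 2).

(** This cancels exactly the factor [a r] produced by [weight_coefs_axis_pair]. *)
Lemma lin_norm_sqr (r : R) : 2 < r -> lin_norm r * lin_norm r * (aa r * r) = 1.
Proof.
  intros hr. destruct (aa_props r hr) as [Ha Har].
  assert (H1 : 0 < 1 - aa r ^ 2) by nra.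
  unfold lin_norm.
  replace (q4 r / sqrt (1 - aa r ^ 2) * (q4 r / sqrt (1 - aa r ^ 2))) with
    (q4 r * q4 r / (sqrt (1 - aa r ^ 2) * sqrt (1 - aa r ^ 2)))
    by (field; apply Rgt_not_eq, sqrt_lt_R0, H1).
  rewrite q4_sqr, sqrt_sqrt by lra. field. nra.
Qed.

(** * Orthonormality of the family *)

Definition onfam_torus (r : R) (i : idx) : R -> R -> C :=
  match i with
  | Iconst => two_terms (q4 r) 0 0 0 0 0
  | Iz1 k => two_terms (lin_norm r) (- aa r) (Z.of_nat k + 1) 0 (Z.of_nat k) 0
  | Iz2 k => two_terms (lin_norm r) (- aa r) 0 (Z.of_nat k + 1) 0 (Z.of_nat k)
  | Iz12 k l => reflected_p r (Z.of_nat k) (Z.of_nat l)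
  end.

Lemma Cpow_eit (t : R) (k : nat) : Defs.Cpow (eit t) k = eit (IZR (Z.of_nat k) * t).
Proof.
  induction k as [| k IH].
  - simpl. rewrite Rmult_0_l. symmetry. apply eit_0.
  - rewrite Nat2Z.inj_succ, succ_IZR, Rmult_plus_distr_r, Rmult_1_l, Rplus_comm, eit_plus.
    simpl. now rewrite IH.
Qed.

Lemma Cpow_eit_mono (x y : R) (k l : nat) :
  Cmult (Defs.Cpow (eit x) k) (Defs.Cpow (eit y) l) = mono (Z.of_nat k) (Z.of_nat l) x y.
Proof. now rewrite !Cpow_eit, <- eit_plus. Qed.

Lemma onfam_on_torus (r : R) (i : idx) (x y : R) : r <> 0 ->
  onfam r i (eit x) (eit y) = onfam_torus r i x y :> C.
Proof.
  intros hr. destruct i as [| k | k | k l]; cbn [onfam onfam_torus]; unfold reflected_p, two_terms.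
  - unfold mono. rewrite !Rmult_0_l, Rplus_0_l, eit_0. ring.
  - pose proof (Cpow_eit_mono x y k 0) as H0.
    pose proof (Cpow_eit_mono x y (S k) 0) as H1.
    rewrite Nat2Z.inj_succ in H1. unfold Z.succ in H1. change (Z.of_nat 0) with 0%Z in H0, H1.
    rewrite <- H0, <- H1, RtoC_opp. cbn [Defs.Cpow]. unfold lin_norm. ring.
  - pose proof (Cpow_eit_mono x y 0 k) as H0.
    pose proof (Cpow_eit_mono x y 0 (S k)) as H1.
    rewrite Nat2Z.inj_succ in H1. unfold Z.succ in H1. change (Z.of_nat 0) with 0%Z in H0, H1.
    rewrite <- H0, <- H1, RtoC_opp. cbn [Defs.Cpow]. unfold lin_norm. ring.
  - pose proof (Cpow_eit_mono x y (S k) (S l)) as H0.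
    pose proof (Cpow_eit_mono x y k (S l)) as H1.
    pose proof (Cpow_eit_mono x y (S k) l) as H2.
    rewrite (Nat2Z.inj_succ k) in H0, H2. rewrite (Nat2Z.inj_succ l) in H0, H1.
    unfold Z.succ in H0, H1, H2.
    rewrite <- H0, <- H1, <- H2, RtoC_opp, RtoC_inv by exact hr. simpl. unfold Cdiv. ring.
Qed.

Lemma inner_onfam (r : R) (i j : idx) : 2 < r ->
  inner r (onfam r i) (onfam r j) = form r (onfam_torus r i) (onfam_torus r j).
Proof. intros hr. apply inner_form; intros x y; apply onfam_on_torus; lra. Qed.

Lemma bounded_lip_onfam_torus (r : R) (i : idx) : bounded_lip (onfam_torus r i).
Proof. destruct i; simpl; auto using bounded_lip_two_terms, bounded_lip_reflected_p. Qed.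

Lemma form_lin_lin_z1 (r : R) (k l : nat) : 2 < r ->
  form r (onfam_torus r (Iz1 k)) (onfam_torus r (Iz1 l)) = delta (Z.of_nat k - Z.of_nat l) 0.
Proof.
  intros hr. pose proof (weight_coefs_weight r hr) as Hc.
  simpl onfam_torus. rewrite form_two_terms_two_terms by exact hr.
  set (c := fourier_coef (weight r)) in *. set (j := (Z.of_nat k - Z.of_nat l)%Z).
  replace (Z.of_nat k + 1 - (Z.of_nat l + 1))%Z with j by lia.
  replace (Z.of_nat k + 1 - Z.of_nat l)%Z with (j + 1)%Z by lia.
  replace (Z.of_nat k - (Z.of_nat l + 1))%Z with (j - 1)%Z by lia.
  change (0 - 0)%Z with 0%Z.
  rewrite (weight_coefs_axis_pair r c j hr Hc), Cmult_assoc, <- !RtoC_mult.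
  rewrite lin_norm_sqr by exact hr. ring.
Qed.

(** Symmetry of the moments exchanges the two variables and reduces this to [z1]. *)
Lemma form_lin_lin_z2 (r : R) (k l : nat) : 2 < r ->
  form r (onfam_torus r (Iz2 k)) (onfam_torus r (Iz2 l)) = delta (Z.of_nat k - Z.of_nat l) 0.
Proof.
  intros hr. pose proof (weight_coefs_weight r hr) as Hc.
  rewrite <- (form_lin_lin_z1 r) by exact hr. simpl onfam_torus.
  rewrite !form_two_terms_two_terms by exact hr.
  set (c := fourier_coef (weight r)) in *. change (0 - 0)%Z with 0%Z.
  now rewrite !(weight_coefs_sym r c 0) by assumption.
Qed.

(** The squared constant [(1 - a^2) / (a r)] is the inverse of the moment at the origin. *)
Lemma form_const_const (r : R) : 2 < r ->
  form r (onfam_torus r Iconst) (onfam_torus r Iconst) = RtoC 1.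
Proof.
  intros hr. pose proof (weight_coefs_weight r hr) as Hc.
  destruct (aa_props r hr) as [Ha Har].
  simpl onfam_torus. rewrite form_two_terms_two_terms by exact hr.
  set (c := fourier_coef (weight r)) in *. change (0 - 0)%Z with 0%Z.
  transitivity (Cmult (RtoC (q4 r * q4 r)) (c 0%Z 0%Z)); [rewrite RtoC_mult; ring |].
  rewrite q4_sqr by exact hr.
  replace ((1 - aa r ^ 2) / (aa r * r)) with (/ (aa r * r) * (1 - aa r ^ 2)) by (unfold Rdiv; ring).
  rewrite RtoC_mult, <- Cmult_assoc, (weight_coefs_origin r c hr Hc), <- RtoC_mult.
  f_equal. apply Rinv_l. nra.
Qed.

Lemma form_z1_const (r : R) (k : nat) : 2 < r ->
  form r (onfam_torus r (Iz1 k)) (onfam_torus r Iconst) = RtoC 0.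
Proof.
  intros hr. pose proof (weight_coefs_weight r hr) as Hc.
  simpl onfam_torus. rewrite form_two_terms_two_terms by exact hr.
  set (c := fourier_coef (weight r)) in *. change (0 - 0)%Z with 0%Z. rewrite !Z.sub_0_r.
  rewrite (weight_coefs_axis_pos r c) by (auto; lia). rewrite RtoC_opp. ring.
Qed.

Lemma form_z2_const (r : R) (k : nat) : 2 < r ->
  form r (onfam_torus r (Iz2 k)) (onfam_torus r Iconst) = RtoC 0.
Proof.
  intros hr. pose proof (weight_coefs_weight r hr) as Hc.
  rewrite <- (form_z1_const r k hr). simpl onfam_torus.
  rewrite !form_two_terms_two_terms by exact hr.
  set (c := fourier_coef (weight r)) in *. change (0 - 0)%Z with 0%Z.
  now rewrite !(weight_coefs_sym r c 0) by assumption.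
Qed.

(** The four moments lie in rows [-(l+1)] and [-l]; within each row the geometric relation cancels
    the pair. *)
Lemma form_z1_z2 (r : R) (k l : nat) : 2 < r ->
  form r (onfam_torus r (Iz1 k)) (onfam_torus r (Iz2 l)) = RtoC 0.
Proof.
  intros hr. pose proof (weight_coefs_weight r hr) as Hc.
  simpl onfam_torus. rewrite form_two_terms_two_terms by exact hr.
  set (c := fourier_coef (weight r)) in *.
  rewrite !Z.sub_0_r, (Z.sub_0_l (Z.of_nat l + 1)), (Z.sub_0_l (Z.of_nat l)).
  replace (Z.of_nat l + 1)%Z with (Z.of_nat (S l)) by lia.
  rewrite (weight_coefs_quadrant r c k (S l)), (weight_coefs_quadrant r c k l) by assumption.
  rewrite RtoC_opp. ring.
Qed.

Lemma orthogonal_sym (r : R) (F G : R -> R -> C) : 2 < r -> bounded_lip F -> bounded_lip G ->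
  form r F G = RtoC 0 -> form r G F = RtoC 0.
Proof.
  intros hr HF HG H. rewrite form_conj, H by assumption.
  apply injective_projections; simpl; ring.
Qed.

Lemma form_onfam_self (r : R) (i : idx) : 2 < r ->
  form r (onfam_torus r i) (onfam_torus r i) = RtoC 1.
Proof.
  intros hr. destruct i as [| k | k | k l].
  - apply form_const_const, hr.
  - now rewrite form_lin_lin_z1, Z.sub_diag by exact hr.
  - now rewrite form_lin_lin_z2, Z.sub_diag by exact hr.
  - simpl. now rewrite form_reflected_p_reflected_p, !Z.sub_diag by exact hr.
Qed.

Lemma form_onfam_neq (r : R) (i j : idx) : 2 < r -> i <> j ->
  form r (onfam_torus r i) (onfam_torus r j) = RtoC 0.
Proof.
  intros hr.
  (* Every monomial of such a member has exponent [0] in one variable, hence at most [k] or at most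
     [l]. *)
  assert (H12 : forall i k l, match i with Iz12 _ _ => False | _ => True end ->
    form r (onfam_torus r i) (onfam_torus r (Iz12 k l)) = RtoC 0).
  { intros [| k' | k' | k' l'] k l Hi; simpl; try contradiction;
      apply form_two_terms_reflected_p; auto; lia. }
  assert (H21 : forall i k l, match i with Iz12 _ _ => False | _ => True end ->
    form r (onfam_torus r (Iz12 k l)) (onfam_torus r i) = RtoC 0).
  { intros i0 k l Hi. apply orthogonal_sym; auto using bounded_lip_onfam_torus. }
  destruct i as [| k | k | k l], j as [| k' | k' | k' l']; intros Hij.
  - now contradict Hij.
  - apply orthogonal_sym; auto using bounded_lip_onfam_torus, form_z1_const.
  - apply orthogonal_sym; auto using bounded_lip_onfam_torus, form_z2_const.
  - exact (H12 Iconst k' l' I).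
  - now apply form_z1_const.
  - rewrite form_lin_lin_z1 by exact hr. apply delta_neq. left.
    intros E. apply Hij. f_equal. lia.
  - now apply form_z1_z2.
  - exact (H12 (Iz1 k) k' l' I).
  - now apply form_z2_const.
  - apply orthogonal_sym; auto using bounded_lip_onfam_torus, form_z1_z2.
  - rewrite form_lin_lin_z2 by exact hr. apply delta_neq. left.
    intros E. apply Hij. f_equal. lia.
  - exact (H12 (Iz2 k) k' l' I).
  - exact (H21 Iconst k l I).
  - exact (H21 (Iz1 k') k l I).
  - exact (H21 (Iz2 k') k l I).
  - simpl. rewrite form_reflected_p_reflected_p by exact hr. apply delta_neq.
    destruct (Nat.eq_dec k k') as [-> | Hk]; [right | left; lia].
    intros E. apply Hij. f_equal. lia.
Qed.

(** * Equality of the span with the space of polynomials *)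

Definition in_span (r : R) (f : C -> C -> C) : Prop :=
  exists M, forall z1 z2, f z1 z2 = span_eval r M z1 z2.

Lemma in_span_ext (r : R) (f g : C -> C -> C) :
  (forall z1 z2, f z1 z2 = g z1 z2) -> in_span r g -> in_span r f.
Proof. intros H [M HM]. exists M. intros. now rewrite H. Qed.

Lemma in_span_plus (r : R) (f g : C -> C -> C) : in_span r f -> in_span r g ->
  in_span r (fun z1 z2 => Cplus (f z1 z2) (g z1 z2)).
Proof.
  intros [M HM] [N HN]. exists (M ++ N). intros z1 z2. rewrite HM, HN. clear HM HN.
  induction M as [| [c i] M IH]; simpl; [ring |]. rewrite <- IH. ring.
Qed.

Lemma in_span_scal (r : R) (k : C) (f : C -> C -> C) : in_span r f ->
  in_span r (fun z1 z2 => Cmult k (f z1 z2)).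
Proof.
  intros [M HM]. exists (map (fun t => (Cmult k (fst t), snd t)) M). intros z1 z2. rewrite HM.
  clear HM. induction M as [| [c i] M IH]; simpl; [ring |]. rewrite <- IH. ring.
Qed.

Lemma in_span_onfam (r : R) (i : idx) : in_span r (onfam r i).
Proof. exists ((RtoC 1, i) :: nil). intros. simpl. now rewrite Cmult_1_l, Cplus_0_r. Qed.

Lemma q4_neq_0 (r : R) : 2 < r -> q4 r <> 0.
Proof.
  intros hr E. pose proof (lin_norm_sqr r hr) as H. unfold lin_norm in H. rewrite E in H.
  unfold Rdiv in H. rewrite Rmult_0_l in H. lra.
Qed.

Lemma lin_norm_neq_0 (r : R) : 2 < r -> lin_norm r <> 0.
Proof. intros hr E. pose proof (lin_norm_sqr r hr) as H. rewrite E in H. lra. Qed.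

(** Induction on [m], then on [n]. Pure powers come from [z^(n+1) = z^n (z - a) + a z^n], starting
    from the constant. *)
Lemma in_span_monomial (r : R) (m n : nat) : 2 < r ->
  in_span r (fun z1 z2 => Cmult (Defs.Cpow z1 m) (Defs.Cpow z2 n)).
Proof.
  intros hr.
  assert (Hq : Cmult (RtoC (/ q4 r)) (RtoC (q4 r)) = RtoC 1)
    by (rewrite <- RtoC_mult; f_equal; apply Rinv_l, q4_neq_0, hr).
  assert (Hs : Cmult (RtoC (/ lin_norm r)) (RtoC (lin_norm r)) = RtoC 1)
    by (rewrite <- RtoC_mult; f_equal; apply Rinv_l, lin_norm_neq_0, hr).
  assert (H0 : in_span r (fun _ _ => Cmult (RtoC 1) (RtoC 1))).
  { apply in_span_ext with (2 := in_span_scal r (RtoC (/ q4 r)) _ (in_span_onfam r Iconst)).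
    intros z1 z2. simpl. rewrite Hq. ring. }
  assert (step : forall u v : C, u = Cplus (Cmult (RtoC (/ lin_norm r)) (Cmult (RtoC (lin_norm r))
    (Cminus u v))) v).
  { intros u v. rewrite Cmult_assoc, Hs. ring. }
  revert n. induction m as [| m IHm]; intros n.
  - induction n as [| n IHn]; [exact H0 |].
    apply in_span_ext with (2 := in_span_plus r _ _
      (in_span_scal r (RtoC (/ lin_norm r)) _ (in_span_onfam r (Iz2 n)))
      (in_span_scal r (RtoC (aa r)) _ IHn)).
    intros z1 z2. cbn [onfam Defs.Cpow]. fold (lin_norm r).
    rewrite (step (Cmult (RtoC 1) (Cmult z2 (Defs.Cpow z2 n)))
      (Cmult (RtoC (aa r)) (Cmult (RtoC 1) (Defs.Cpow z2 n)))). ring.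
  - induction n as [| n IHn].
    + apply in_span_ext with (2 := in_span_plus r _ _
        (in_span_scal r (RtoC (/ lin_norm r)) _ (in_span_onfam r (Iz1 m)))
        (in_span_scal r (RtoC (aa r)) _ (IHm 0%nat))).
      intros z1 z2. cbn [onfam Defs.Cpow]. fold (lin_norm r).
      rewrite (step (Cmult (Cmult z1 (Defs.Cpow z1 m)) (RtoC 1))
        (Cmult (RtoC (aa r)) (Cmult (Defs.Cpow z1 m) (RtoC 1)))). ring.
    (* [IHn] supplies [z1^(m+1) z2^n] and [IHm (S n)] supplies [z1^m z2^(n+1)], the two monomials
       subtracted with factor [1/r] in the member [(m, n)]. *)
    + apply in_span_ext with (2 := in_span_plus r _ _ (in_span_onfam r (Iz12 m n))
        (in_span_scal r (Cinv (RtoC r)) _ (in_span_plus r _ _ IHn (IHm (S n))))).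
      intros z1 z2. simpl. unfold Cdiv. ring.
Qed.

Lemma poly_in_span (r : R) (L : list (C * nat * nat)) : 2 < r -> in_span r (poly_eval L).
Proof.
  intros hr. induction L as [| [[c m] n] L IH].
  - exists nil. reflexivity.
  - exact (in_span_plus r _ _ (in_span_scal r c _ (in_span_monomial r m n hr)) IH).
Qed.

Definition is_poly (f : C -> C -> C) : Prop :=
  exists L, forall z1 z2, f z1 z2 = poly_eval L z1 z2.

Lemma is_poly_plus (f g : C -> C -> C) : is_poly f -> is_poly g ->
  is_poly (fun z1 z2 => Cplus (f z1 z2) (g z1 z2)).
Proof.
  intros [M HM] [N HN]. exists (M ++ N). intros z1 z2. rewrite HM, HN. clear HM HN.
  induction M as [| [[c m] n] M IH]; simpl; [ring |]. rewrite <- IH. ring.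
Qed.

Lemma is_poly_scal (k : C) (f : C -> C -> C) : is_poly f ->
  is_poly (fun z1 z2 => Cmult k (f z1 z2)).
Proof.
  intros [M HM]. exists (map (fun t => (Cmult k (fst (fst t)), snd (fst t), snd t)) M).
  intros z1 z2. rewrite HM.
  clear HM. induction M as [| [[c m] n] M IH]; simpl; [ring |]. rewrite <- IH. ring.
Qed.

Lemma is_poly_onfam (r : R) (i : idx) : is_poly (onfam r i).
Proof.
  destruct i as [| k | k | k l].
  - exists ((RtoC (q4 r), 0, 0)%nat :: nil). intros. simpl. unfold Cc. ring.
  - exists ((RtoC (lin_norm r), S k, 0)%nat
      :: (Copp (Cmult (RtoC (lin_norm r)) (RtoC (aa r))), k, 0)%nat
      :: nil).
    intros. cbn [onfam poly_eval fold_right Defs.Cpow]. unfold Cc. fold (lin_norm r). ring.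
  - exists ((RtoC (lin_norm r), 0, S k)%nat
      :: (Copp (Cmult (RtoC (lin_norm r)) (RtoC (aa r))), 0, k)%nat
      :: nil).
    intros. cbn [onfam poly_eval fold_right Defs.Cpow]. unfold Cc. fold (lin_norm r). ring.
  - exists ((RtoC 1, S k, S l)
      :: (Copp (Cinv (RtoC r)), S k, l) :: (Copp (Cinv (RtoC r)), k, S l) :: nil).
    intros. simpl. unfold Cc, Cdiv. ring.
Qed.

Lemma span_is_poly (r : R) (M : list (C * idx)) : is_poly (span_eval r M).
Proof.
  induction M as [| [c i] M IH].
  - exists nil. reflexivity.
  - exact (is_poly_plus _ _ (is_poly_scal c _ (is_poly_onfam r i)) IH).
Qed.

Theorem theorem6 (r : R) (hr : 2 < r) :
  (forall i : idx, inner r (onfam r i) (onfam r i) = RtoC 1) /\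
  (forall i j : idx, i <> j -> inner r (onfam r i) (onfam r j) = RtoC 0) /\
  (forall L : list (Cc * nat * nat), exists M : list (Cc * idx),
      forall z1 z2 : Cc, poly_eval L z1 z2 = span_eval r M z1 z2) /\
  (forall M : list (Cc * idx), exists L : list (Cc * nat * nat),
      forall z1 z2 : Cc, span_eval r M z1 z2 = poly_eval L z1 z2).
Proof.
  repeat split.
  - intros i. rewrite inner_onfam by exact hr. apply form_onfam_self, hr.
  - intros i j Hij. rewrite inner_onfam by exact hr. now apply form_onfam_neq.
  - intros L. now apply poly_in_span.
  - intros M. apply span_is_poly.
Qed.
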